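(* $\mathrm{ISN}_\Delta$ games are not generally implementable in a stable manner: it is not the case that every $\mathrm{ISN}_\Delta$ game $(N,v)$ admits a stable allocation; that is, there exists an $\mathrm{ISN}_\Delta$ game whose core is empty.
   Context: A cooperative game (with transferable utility) is a pair $(N,v)$ where $N$ is a finite set of agents, $n=|N|$, and $v:2^N\to\mathbb{R}$. It is superadditive if $v(S\cup T)\ge v(S)+v(T)$ for all disjoint $S,T\subseteq N$. ISN game: let $N$ be a non-empty finite set of industrial agents and, for every $S\subseteq N$, let $T(S)$ and $O(S)$ be real numbers (total traditional cost and total operational cost of $S$). The Industrial Symbiotic Network (ISN) among agents in $N$ is a normalized superadditive cooperative game $(N,v)$ with $v(S)=0$ if $|S|\le 1$ and $v(S)=T(S)-O(S)$ otherwise. (Normalized means that the empty and singleton groups have value $0$.) An $\mathrm{ISN}_\Delta$ game is an ISN game with $|N|\ge 3$. An allocation $x=(x_i)_{i\in N}\in\mathbb{R}^n$ is stable (a core allocation) for $(N,v)$ if it satisfies (RAT) $\sum_{i\in S}x_i\ge v(S)$ for all $S\subseteq N$, and (EFF) $\sum_{i\in N}x_i=v(N)$. The core is the set of stable allocations. A symbiotic relation modeled by $(N,v)$ is implementable in a stable manner if the core of $(N,v)$ is non-empty. *)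

(* Defs.v *)
From HB Require Import structures.
From mathcomp Require Import all_boot all_order all_algebra.
From mathcomp Require Import boolp classical_sets reals.

Set Implicit Arguments.
Unset Strict Implicit.
Unset Printing Implicit Defensive.

Import Order.TTheory GRing.Theory Num.Theory.

Local Open Scope ring_scope.

(* Coalitions are decidable finite sets [{set agents g}], whereas the core, a
   set of allocations, is a classical [set]. *)
Record game (R : realType) := Game {
  agents : finType;
  value : {set agents} -> R
}.

Definition superadditive (R : realType) (g : game R) : Prop :=
  forall S S' : {set agents g}, [disjoint S & S'] ->
    value S + value S' <= value (S :|: S').

Definition normalized (R : realType) (g : game R) : Prop :=
  forall S : {set agents g}, (#|S| <= 1)%N -> value S = 0.

(* [T S] is the total traditional cost of [S], [O S] its total operational
   cost; no sign or monotonicity condition is imposed on either. *)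
Definition isn_value (R : realType) (N : finType) (T O : {set N} -> R)
    (S : {set N}) : R :=
  if (#|S| <= 1)%N then 0 else T S - O S.

Definition ISN (R : realType) (g : game R) : Prop :=
  [/\ (0 < #|agents g|)%N,
      normalized g,
      superadditive g &
      exists T O : {set agents g} -> R,
        forall S : {set agents g}, value S = isn_value T O S].

Definition ISN_Delta (R : realType) (g : game R) : Prop :=
  ISN g /\ (3 <= #|agents g|)%N.

Definition RAT (R : realType) (g : game R) (x : agents g -> R) : Prop :=
  forall S : {set agents g}, value S <= \sum_(i in S) x i.

Definition EFF (R : realType) (g : game R) (x : agents g -> R) : Prop :=
  \sum_(i : agents g) x i = value [set: agents g].

Definition stable (R : realType) (g : game R) (x : agents g -> R) : Prop :=
  RAT x /\ EFF x.

Definition core (R : realType) (g : game R) : set (agents g -> R) :=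
  [set x | stable x]%classic.

Arguments core {R} g.

Definition stably_implementable (R : realType) (g : game R) : Prop :=
  (core g !=set0)%classic.

(* Main.v *)
Require Import Defs.
From HB Require Import structures.
From mathcomp Require Import all_boot all_order all_algebra.
From mathcomp Require Import boolp classical_sets reals.
From mathcomp Require Import zify.

(** The simple majority game on three agents is superadditive, as two disjoint
    coalitions cannot both be majorities. In a stable allocation, the two
    agents other than [i] receive at least 1, which is the total value, so
    agent [i] receives at most 0; hence the total is at most 0. *)

Set Implicit Arguments.
Unset Strict Implicit.
Unset Printing Implicit Defensive.

Import Order.TTheory GRing.Theory Num.Theory.

Local Open Scope ring_scope.

Definition majority_game (R : realType) : game R :=
  @Game R 'I_3 (fun S => (1 < #|S|)%N%:R).

Lemma majority_superadditive (R : realType) : superadditive (majority_game R).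
Proof.
move=> S S' dSS' /=; rewrite -natrD ler_nat.
have cU : #|S :|: S'| = (#|S| + #|S'|)%N.
  by move: dSS'; rewrite -setI_eq0 cardsU => /eqP ->; rewrite cards0 subn0.
(* The union has at most 3 agents, so [S] and [S'] cannot both have 2; if one of them does, so does
   the union. *)
have := max_card (mem (S :|: S')); rewrite card_ord cU.
case: (ltnP 1 #|S|); case: (ltnP 1 #|S'|); lia.
Qed.

Lemma majority_ISN_Delta (R : realType) : ISN_Delta (majority_game R).
Proof.
split; last by rewrite card_ord.
split; [by rewrite card_ord | | exact: majority_superadditive |].
  by move=> S /= S1; rewrite ltnNge S1.
(* Any normalized game has this form: take its value as traditional cost and zero as operational
   cost. *)
exists (@value R (majority_game R)), (fun=> 0) => S.
by rewrite /isn_value subr0 /=; case: leqP.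
Qed.

Lemma majority_core (R : realType) : core (majority_game R) = set0%classic.
Proof.
apply/seteqP; split=> // x [rat eff].
have {}eff : \sum_(i < 3) x i = 1 by rewrite [LHS]eff /= cardsT card_ord.
have xle0 (i : 'I_3) : x i <= 0.
  have := rat [set~ i]; rewrite /= cardsC1 card_ord /= => rat_i.
  move: eff; rewrite (bigD1 i) //= => eff.
  (* Adding 1 to both sides and writing the right-hand 1 as the total leaves
     [1 <= \sum_(j < 3 | j != i) x j], which [rat_i] provides. *)
  rewrite -(lerD2r 1) add0r -{2}eff lerD2l (le_trans rat_i) //.
  by under eq_bigl do rewrite !inE.
have := @sumr_le0 R 'I_3 (index_enum 'I_3) xpredT x (fun i _ => xle0 i).
by rewrite eff ler10.
Qed.

Theorem theorem2 (R : realType) :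
  ~ (forall g : game R, ISN_Delta g -> stably_implementable g) /\
  (exists g : game R, ISN_Delta g /\ core g = set0%classic).
Proof.
split; last first.
  by exists (majority_game R); split;
    [exact: majority_ISN_Delta | exact: majority_core].
move=> /(_ _ (majority_ISN_Delta R)) [x].
by rewrite majority_core.
Qed.
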